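(* Let $\Omega$ be a Gromov hyperbolic train, with associated sequences $\{l_n\}_{n\ge1},\{r_n\}_{n\ge1}$, and suppose there is a constant $c_1>0$ with $l_m\le l_n+c_1$ for all positive integers $m\le n$. Let $$K:=\sup_{n\ge 1}\ \sup_{h\in[0,l_n]}\ \min_{m\in[A_n(h),B_n(h)]}\Gamma_{nm}(h).$$ Then $$r_n\le 2\max\{K,1\}+2\log\max\{K,1\}+3c_1\qquad\text{for every } n \text{ with } l_{n+1}>4(K+c_1).$$
   Context: Trains. A train is a domain $\Omega\subset\mathbb C$ whose boundary in the Riemann sphere is contained in $\mathbb R\cup\{\infty\}$ and such that $\Omega\cap\mathbb R=\bigcup_{n=0}^\infty (a_n,b_n)$ with $-\infty\le a_0$ and $a_n<b_n\le a_{n+1}$ for every $n\ge0$. It is endowed with its Poincaré metric (the complete metric of constant curvature $-1$ obtained by projecting $2|dz|/(1-|z|^2)$ from the unit disk, its universal cover) and the induced distance. For $n\ge1$, the fundamental geodesic $\gamma_n$ is the unique simple closed geodesic which intersects $\mathbb R$ just in $(a_0,b_0)$ and $(a_n,b_n)$, and $2l_n$ is its length. For $n\ge1$, the second fundamental geodesic $\sigma_n$ is the unique simple closed geodesic which intersects $\mathbb R$ just in $(a_n,b_n)$ and $(a_{n+1},b_{n+1})$, and $2r_n$ is its length. Punctures are regarded as simple closed geodesics of length zero: if $b_n=a_{n+1}$ then $r_n=0$, and if $b_0=a_1$ then $l_1=0$. Hyperbolicity. For a metric space $(X,d)$ the Gromov product is $(x|y)_w=\frac12(d(x,w)+d(y,w)-d(x,y))$.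 $X$ is $\delta$-hyperbolic ($\delta\ge0$) if $(x|z)_w\ge\min\{(x|y)_w,(y|z)_w\}-\delta$ for all $x,y,z,w\in X$, and (Gromov) hyperbolic if it is $\delta$-hyperbolic for some $\delta\ge 0$. (For a hyperbolic train the quantity $K$ is finite.) The functions. Write $x_+=\max\{x,0\}$; empty sums are $0$. For $n\ge1$ and $0\le h\le l_n$: $A_n(h):=\max\{m\ge 1: m<n,\ l_m\le h\}$ if this set is non-empty, and $A_n(h):=1$ otherwise; $B_n(h):=\min\{m>n:\ l_m\le h\}$ if this set is non-empty, and $B_n(h):=\infty$ otherwise. The index $m$ ranges over (finite) positive integers. Put, for $k\ge1$, $$\Delta(k):=e^{-l_k}+e^{-l_{k+1}}+e^{-\frac12(l_k+l_{k+1}-r_k)_+}+(r_k-l_k-l_{k+1})_+,$$ and, for $n,m\ge1$ and $0\le h\le l_n$, $$\Gamma_{nm}(h):=\begin{cases}(r_m+h-l_{m+1})_+ + e^h\sum_{k=m+1}^{n-1}\Delta(k), & m<n,\ l_m\le h,\\ l_m-h+e^h\sum_{k=m}^{n-1}\Delta(k), & m<n,\ l_m>h,\\ \min\{h,\,l_n-h\}, & m=n,\\ l_m-h+e^h\sum_{k=n}^{m-1}\Delta(k), & m>n,\ l_m>h,\\ (r_{m-1}+h-l_{m-1})_+ + e^h\sum_{k=n}^{m-2}\Delta(k), & m>n,\ l_m\le h.\end{cases}$$ *)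

(* Defs.v *)
From Stdlib Require Import Reals Lra Lia Classical Arith.
From Coquelicot Require Import Coquelicot.

Open Scope R_scope.

(** * Trains *)

Definition boundary (S : C -> Prop) (z : C) : Prop :=
  forall P : C -> Prop, locally z P ->
    (exists w, P w /\ S w) /\ (exists w, P w /\ ~ S w).

Definition connected_set (S : C -> Prop) : Prop :=
  forall U V : C -> Prop, open U -> open V ->
    (forall z, S z -> U z \/ V z) ->
    (exists z, S z /\ U z) -> (exists z, S z /\ V z) ->
    exists z, S z /\ U z /\ V z.

Definition domain (S : C -> Prop) : Prop :=
  open S /\ connected_set S /\ exists z, S z.

Definition in_interval (u v : Rbar) (x : R) : Prop :=
  Rbar_lt u x /\ Rbar_lt x v.

(** The boundary of [Omega] in the sphere minus the point at infinity is its
    boundary in [C], so the inclusion in the extended real line only constrains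
    the latter.  The order conditions force every [a n], [b n] except possibly
    [a 0] to be finite. *)
Definition train (Omega : C -> Prop) (a b : nat -> Rbar) : Prop :=
  domain Omega /\
  (forall z, boundary Omega z -> Im z = 0) /\
  (forall x : R, Omega (RtoC x) <-> exists n, in_interval (a n) (b n) x) /\
  (forall n, Rbar_lt (a n) (b n) /\ Rbar_le (b n) (a (S n))).

(** * The Poincaré metric *)

Definition unit_disk (z : C) : Prop := Cmod z < 1.

Definition homeomorphism_on (V U : C -> Prop) (p : C -> C) : Prop :=
  (forall z, V z -> U (p z) /\ continuous p z) /\
  exists s : C -> C,
    (forall w, U w -> V (s w) /\ continuous s w /\ p (s w) = w) /\
    (forall z, V z -> s (p z) = z).

(** [D] and [Omega] are meant to be open, and the sheets are required to be open,
    so continuity at a point of [C] is continuity for the subspace topologies. *)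
Definition covering_map (D Omega : C -> Prop) (p : C -> C) : Prop :=
  (forall z, D z -> Omega (p z) /\ continuous p z) /\
  (forall w, Omega w -> exists z, D z /\ p z = w) /\
  (forall w, Omega w ->
    exists U : C -> Prop, open U /\ U w /\ (forall u, U u -> Omega u) /\
    exists (I : Type) (V : I -> C -> Prop),
      (forall i, open (V i)) /\
      (forall i j z, V i z -> V j z -> i = j) /\
      (forall z, (D z /\ U (p z)) <-> exists i, V i z) /\
      (forall i, homeomorphism_on (V i) U p)).

Definition holomorphic_on (D : C -> Prop) (p : C -> C) : Prop :=
  forall z : C, D z -> ex_derive (K := C_AbsRing) (V := C_NormedModule) p z.

(** [lam w |dw|] is the projection of [2|dz|/(1-|z|^2)] by a universal covering;
    the values of [lam] outside [Omega] are irrelevant. *)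
Definition poincare_density (Omega : C -> Prop) (lam : C -> R) : Prop :=
  exists p : C -> C,
    holomorphic_on unit_disk p /\ covering_map unit_disk Omega p /\
    forall z, unit_disk z ->
      lam (p z) * Cmod (C_derive p z) = 2 / (1 - Cmod z ^ 2).

(** The speed is allowed to vanish, so that piecewise C^1 paths are covered up to
    reparametrization. *)
Definition path_of_length (Omega : C -> Prop) (lam : C -> R) (x y : C) (L : R) : Prop :=
  exists g g' : R -> C,
    (forall t, 0 <= t <= 1 ->
       Omega (g t) /\ is_derive g t (g' t) /\ continuous g' t) /\
    g 0 = x /\ g 1 = y /\
    L = RInt (fun t => lam (g t) * Cmod (g' t)) 0 1.

Definition poincare_dist (Omega : C -> Prop) (lam : C -> R) (x y : C) : R :=
  real (Glb_Rbar (path_of_length Omega lam x y)).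

(** * Fundamental geodesics *)

(** A closed geodesic of length [L], parametrized by arc length on [R]. *)
Definition simple_closed_geodesic
    (Omega : C -> Prop) (lam : C -> R) (g : R -> C) (L : R) : Prop :=
  0 < L /\
  (forall t, Omega (g t)) /\
  (forall t, g (t + L) = g t) /\
  (forall s t, 0 <= s < L -> 0 <= t < L -> g s = g t -> s = t) /\
  (exists eps, 0 < eps /\ forall s t, Rabs (s - t) < eps ->
     poincare_dist Omega lam (g s) (g t) = Rabs (s - t)).

Definition meets_R_just_in (a b : nat -> Rbar) (i j : nat) (g : R -> C) : Prop :=
  (exists t, Im (g t) = 0 /\ in_interval (a i) (b i) (Re (g t))) /\
  (exists t, Im (g t) = 0 /\ in_interval (a j) (b j) (Re (g t))) /\
  (forall t, Im (g t) = 0 ->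
     in_interval (a i) (b i) (Re (g t)) \/ in_interval (a j) (b j) (Re (g t))).

(** [x] is half the length of the simple closed geodesic meeting the real line just
    in the intervals [i < j]; a puncture [b i = a j] (possible only if
    [j = S i]) is a geodesic of length zero. *)
Definition geodesic_half_length (Omega : C -> Prop) (a b : nat -> Rbar)
    (lam : C -> R) (i j : nat) (x : R) : Prop :=
  (b i = a j /\ x = 0) \/
  (b i <> a j /\ exists g : R -> C,
     simple_closed_geodesic Omega lam g (2 * x) /\ meets_R_just_in a b i j g).

(** Index [0] of [l] and [r] is unused. *)
Definition train_lengths (Omega : C -> Prop) (a b : nat -> Rbar)
    (lam : C -> R) (l r : nat -> R) : Prop :=
  forall n, (1 <= n)%nat ->
    geodesic_half_length Omega a b lam 0 n (l n) /\
    geodesic_half_length Omega a b lam n (S n) (r n).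

(** * Gromov hyperbolicity *)

Definition gromov_product (d : C -> C -> R) (x y w : C) : R :=
  / 2 * (d x w + d y w - d x y).

Definition delta_hyperbolic (X : C -> Prop) (d : C -> C -> R) (delta : R) : Prop :=
  forall x y z w, X x -> X y -> X z -> X w ->
    Rmin (gromov_product d x y w) (gromov_product d y z w) - delta
    <= gromov_product d x z w.

Definition gromov_hyperbolic (X : C -> Prop) (d : C -> C -> R) : Prop :=
  exists delta, 0 <= delta /\ delta_hyperbolic X d delta.

(** * The functions [A], [B], [Delta], [Gamma] and the constant [K] *)

Definition pos_part (x : R) : R := Rmax x 0.

Definition is_A (l : nat -> R) (n : nat) (h : R) (A : nat) : Prop :=
  let E m := (1 <= m < n)%nat /\ l m <= h in
  (E A /\ forall m, E m -> (m <= A)%nat) \/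
  ((forall m, ~ E m) /\ A = 1%nat).

(** [None] stands for infinity. *)
Definition is_B (l : nat -> R) (n : nat) (h : R) (B : option nat) : Prop :=
  let E m := (n < m)%nat /\ l m <= h in
  match B with
  | Some B => E B /\ forall m, E m -> (B <= m)%nat
  | None => forall m, ~ E m
  end.

Definition in_window (l : nat -> R) (n : nat) (h : R) (m : nat) : Prop :=
  exists A B, is_A l n h A /\ is_B l n h B /\ (A <= m)%nat /\
    match B with Some B => (m <= B)%nat | None => True end.

Definition Delta (l r : nat -> R) (k : nat) : R :=
  exp (- l k) + exp (- l (S k))
  + exp (- / 2 * pos_part (l k + l (S k) - r k))
  + pos_part (r k - l k - l (S k)).

(** [sum_n_m u p q] is [0] when [q < p]. *)
Definition Gamma (l r : nat -> R) (n m : nat) (h : R) : R :=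
  match Nat.compare m n with
  | Lt =>
      if Rle_dec (l m) h
      then pos_part (r m + h - l (m + 1)%nat)
           + exp h * sum_n_m (Delta l r) (m + 1) (n - 1)
      else l m - h + exp h * sum_n_m (Delta l r) m (n - 1)
  | Eq => Rmin h (l n - h)
  | Gt =>
      if Rle_dec (l m) h
      then pos_part (r (m - 1)%nat + h - l (m - 1)%nat)
           + exp h * sum_n_m (Delta l r) n (m - 2)
      else l m - h + exp h * sum_n_m (Delta l r) n (m - 1)
  end.

Definition is_min (E : R -> Prop) (x : R) : Prop :=
  E x /\ forall y, E y -> x <= y.

Definition Gamma_values (l r : nat -> R) (n : nat) (h : R) (y : R) : Prop :=
  exists m, in_window l n h m /\ y = Gamma l r n m h.

(** The minimum always exists, even over an infinite window: see [Gamma_min_exists].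
    The supremum is taken in the extended reals. *)
Definition K (l r : nat -> R) : Rbar :=
  Lub_Rbar (fun x => exists n h, (1 <= n)%nat /\ 0 <= h <= l n /\
    is_min (Gamma_values l r n h) x).

(** ** Existence of the minimum *)

Lemma finite_argmin (P : nat -> Prop) (f : nat -> R) (N : nat) :
  (exists m, (m <= N)%nat /\ P m) ->
  exists m, P m /\ forall k, (k <= N)%nat -> P k -> f m <= f k.
Proof.
  induction N as [|N IH]; intros [m [Hm Pm]].
  - exists m; split; [exact Pm|]. intros k Hk _.
    replace k with m by lia. lra.
  - destruct (classic (exists m, (m <= N)%nat /\ P m)) as [H|H].
    + destruct (IH H) as [q [Pq Hq]].
      destruct (classic (P (S N))) as [PS|PS].
      * destruct (Rle_dec (f q) (f (S N))) as [Hle|Hle].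
        -- exists q; split; [exact Pq|]. intros k Hk Pk.
           destruct (Nat.eq_dec k (S N)) as [->|Hne]; [exact Hle|].
           apply Hq; [lia|exact Pk].
        -- exists (S N); split; [exact PS|]. intros k Hk Pk.
           destruct (Nat.eq_dec k (S N)) as [->|Hne]; [lra|].
           apply Rle_trans with (f q); [lra|]. apply Hq; [lia|exact Pk].
      * exists q; split; [exact Pq|]. intros k Hk Pk.
        destruct (Nat.eq_dec k (S N)) as [->|Hne]; [contradiction|].
        apply Hq; [lia|exact Pk].
    + exists m; split; [exact Pm|]. intros k Hk Pk.
      assert (m = S N) by (destruct (Nat.eq_dec m (S N)); [auto|
        exfalso; apply H; exists m; split; [lia|auto]]).
      assert (k = S N) by (destruct (Nat.eq_dec k (S N)); [auto|
        exfalso; apply H; exists k; split; [lia|auto]]).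
      subst; lra.
Qed.

Lemma Delta_pos (l r : nat -> R) (k : nat) : exp (- l k) <= Delta l r k.
Proof.
  unfold Delta, pos_part.
  pose proof (exp_pos (- l (S k))).
  pose proof (exp_pos (- / 2 * Rmax (l k + l (S k) - r k) 0)).
  pose proof (Rmax_r (r k - l k - l (S k)) 0). lra.
Qed.

Lemma sum_Delta_step (l r : nat -> R) (n m : nat) : (n <= S m)%nat ->
  sum_n_m (Delta l r) n (S m) = sum_n_m (Delta l r) n m + Delta l r (S m).
Proof. intros H. rewrite sum_n_Sm by exact H. reflexivity. Qed.

Lemma sum_Delta_mono (l r : nat -> R) (n p j : nat) : (n <= S p)%nat ->
  sum_n_m (Delta l r) n p <= sum_n_m (Delta l r) n (p + j).
Proof.
  intros H. induction j as [|j IH].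
  - rewrite Nat.add_0_r. lra.
  - rewrite Nat.add_succ_r, sum_Delta_step by lia.
    pose proof (Delta_pos l r (S (p + j))).
    pose proof (exp_pos (- l (S (p + j)))). lra.
Qed.

Lemma sum_Delta_nonneg (l r : nat -> R) (n m : nat) :
  0 <= sum_n_m (Delta l r) n m.
Proof.
  destruct (le_lt_dec n m) as [H|H].
  - destruct n as [|n].
    + replace m with (0 + m)%nat by lia.
      apply Rle_trans with (sum_n_m (Delta l r) 0 0).
      * rewrite sum_n_n. pose proof (Delta_pos l r 0).
        pose proof (exp_pos (- l 0%nat)). lra.
      * apply sum_Delta_mono. lia.
    + replace m with (n + (m - n))%nat by lia.
      apply Rle_trans with (sum_n_m (Delta l r) (S n) n).
      * rewrite sum_n_m_zero by lia. apply Rle_refl.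
      * apply sum_Delta_mono. lia.
  - rewrite sum_n_m_zero by exact H. apply Rle_refl.
Qed.

Lemma Gamma_tail (l r : nat -> R) (n : nat) (h c : R) :
  (1 <= n)%nat -> 0 <= h ->
  (forall m, (n < m)%nat -> h < l m) ->
  exists N, forall m, (N <= m)%nat -> (n < m)%nat -> c < Gamma l r n m h.
Proof.
  intros Hn Hh Hl. apply NNPP. intros Hno.
  assert (Hinf : forall N, exists m, (N <= m)%nat /\ (n < m)%nat /\
            l m - h + sum_n_m (Delta l r) n (m - 1) <= c).
  { intros N. apply NNPP. intros Hc. apply Hno. exists N. intros m HN Hm.
    apply Rnot_le_lt. intros HG. apply Hc. exists m. repeat split; try assumption.
    revert HG. unfold Gamma.
    replace (Nat.compare m n) with Gt by (symmetry; apply Nat.compare_gt_iff; lia).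
    destruct (Rle_dec (l m) h) as [Hle|_]; [specialize (Hl m Hm); lra|].
    pose proof (sum_Delta_nonneg l r n (m - 1)).
    assert (1 <= exp h) by (pose proof (exp_ineq1_le h); lra).
    nra. }
  set (e := exp (- (c + h))).
  assert (He : 0 < e) by apply exp_pos.
  assert (Hgrow : forall j, exists p, (n <= S p)%nat /\
            INR j * e <= sum_n_m (Delta l r) n p).
  { induction j as [|j [p [Hp IH]]].
    - exists n. split; [lia|]. simpl.
      pose proof (sum_Delta_nonneg l r n n). lra.
    - destruct (Hinf (S p)) as [m [HN [Hm Hle]]].
      exists m. split; [lia|].
      destruct m as [|q]; [lia|].
      rewrite sum_Delta_step by lia.
      replace q with (p + (q - p))%nat at 1 by lia.
      pose proof (sum_Delta_mono l r n p (q - p) Hp).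
      pose proof (Delta_pos l r (S q)).
      pose proof (sum_Delta_nonneg l r n (S q - 1)).
      assert (e <= exp (- l (S q))).
      { unfold e. destruct (Req_dec (c + h) (l (S q))) as [->|Hne]; [lra|].
        left. apply exp_increasing. lra. }
      rewrite S_INR. lra. }
  destruct (INR_archimed e (Rabs c + 1) He) as [j Hj].
  destruct (Hgrow j) as [p [Hp Hs]].
  destruct (Hinf (S (S p))) as [m [HN [Hm Hle]]].
  replace (m - 1)%nat with (p + (m - 1 - p))%nat in Hle by lia.
  pose proof (sum_Delta_mono l r n p (m - 1 - p) Hp).
  specialize (Hl m Hm). pose proof (Rle_abs c). lra.
Qed.

Lemma is_A_exists (l : nat -> R) (n : nat) (h : R) :
  (1 <= n)%nat -> exists A, is_A l n h A /\ (A <= n)%nat.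
Proof.
  intros Hn. unfold is_A.
  destruct (classic (exists m, (1 <= m < n)%nat /\ l m <= h)) as [[m Hm]|H].
  - destruct (finite_argmin (fun m => (1 <= m < n)%nat /\ l m <= h)
               (fun m => - INR m) n) as [A [HA Hmax]].
    { exists m. split; [lia|exact Hm]. }
    exists A. split; [left; split; [exact HA|]|lia].
    intros k Hk. apply INR_le. specialize (Hmax k ltac:(lia) Hk). lra.
  - exists 1%nat. split; [right; split; [|reflexivity]|exact Hn].
    intros m Hm. apply H. exists m. exact Hm.
Qed.

Lemma is_B_exists (l : nat -> R) (n : nat) (h : R) :
  exists B, is_B l n h B /\ match B with Some B => (n <= B)%nat | None => True end.
Proof.
  unfold is_B.
  destruct (classic (exists m, (n < m)%nat /\ l m <= h)) as [[m Hm]|H].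
  - destruct (finite_argmin (fun m => (n < m)%nat /\ l m <= h) INR m)
      as [B [HB Hmin]].
    { exists m. split; [lia|exact Hm]. }
    exists (Some B). split; [split; [exact HB|]|lia].
    intros k Hk. destruct (le_lt_dec k m) as [Hle|Hlt].
    + apply INR_le. exact (Hmin k Hle Hk).
    + apply Nat.le_trans with m; [|lia]. apply INR_le. exact (Hmin m ltac:(lia) Hm).
  - exists None. split; [|exact I]. intros m Hm. apply H. exists m. exact Hm.
Qed.

Lemma Gamma_min_exists (l r : nat -> R) (n : nat) (h : R) :
  (1 <= n)%nat -> 0 <= h <= l n ->
  exists x, is_min (Gamma_values l r n h) x.
Proof.
  intros Hn Hh.
  destruct (is_A_exists l n h Hn) as [A [HA HAn]].
  destruct (is_B_exists l n h) as [B [HB HBn]].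
  assert (Hnw : in_window l n h n).
  { exists A, B. repeat split; assumption. }
  assert (Htail : exists N, forall m, in_window l n h m -> (N < m)%nat ->
            Gamma l r n n h <= Gamma l r n m h).
  { destruct B as [B|].
    - exists B. intros m [A' [B' [_ [HB' [_ Hm]]]]] HN. exfalso.
      destruct B' as [B'|].
      + destruct HB' as [_ HB']. specialize (HB' B (proj1 HB)). lia.
      + exact (HB' B (proj1 HB)).
    - destruct (Gamma_tail l r n h (Gamma l r n n h) Hn (proj1 Hh)) as [N HN].
      { intros m Hm. apply Rnot_le_lt. intros Hle.
        exact (HB m (conj Hm Hle)). }
      exists (N + n)%nat. intros m _ Hm. left. apply HN; lia. }
  destruct Htail as [N HN].
  destruct (finite_argmin (in_window l n h) (fun m => Gamma l r n m h) (N + n))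
    as [m [Hm Hmin]].
  { exists n. split; [lia|exact Hnw]. }
  exists (Gamma l r n m h). split.
  - exists m. split; [exact Hm|reflexivity].
  - intros y [k [Hk ->]]. destruct (le_lt_dec k (N + n)) as [Hle|Hlt].
    + exact (Hmin k Hle Hk).
    + apply Rle_trans with (Gamma l r n n h).
      * exact (Hmin n ltac:(lia) Hnw).
      * apply HN; [exact Hk|lia].
Qed.

(* Main.v *)
(** Write [N = S n], [k] for the value of [K], and take [h] slightly below
    [l N - c1 - k]. Every index [m >= N] then has [Gamma l r N m h > k], so the
    minimum defining [K] is attained at some [m <= n]. If [l n <= h], the window
    only leaves [m = n], and [r n + h - l N <= k]. Otherwise the sum in [Gamma]
    contains [Delta n], so [exp (h - (l n + l N - r n)/2) <= k], and
    [l n <= l N + c1] concludes. *)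

Require Import Defs.
From Stdlib Require Import Reals Lra Lia.
From Coquelicot Require Import Coquelicot.
Open Scope R_scope.

Lemma geodesic_half_length_nonneg (Omega : C -> Prop) (a b : nat -> Rbar)
  (lam : C -> R) (i j : nat) (x : R) :
  geodesic_half_length Omega a b lam i j x -> 0 <= x.
Proof. intros [[_ ->]|[_ [g [[H _] _]]]]; lra. Qed.

Lemma pos_part_nonneg (x : R) : 0 <= pos_part x.
Proof. apply Rmax_r. Qed.

Lemma pos_part_ge (x : R) : x <= pos_part x.
Proof. apply Rmax_l. Qed.

Lemma exp_sum_Delta_nonneg (l r : nat -> R) (p q : nat) (h : R) :
  0 <= exp h * sum_n_m (Defs.Delta l r) p q.
Proof.
  apply Rmult_le_pos; [left; apply exp_pos|apply sum_Delta_nonneg].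
Qed.

Lemma Gamma_nonneg (l r : nat -> R) (n m : nat) (h : R) :
  0 <= h <= l n -> 0 <= Gamma l r n m h.
Proof.
  intros Hh. unfold Gamma.
  destruct (Nat.compare m n); [apply Rmin_glb; lra|..];
    (destruct (Rle_dec (l m) h); apply Rplus_le_le_0_compat;
     [apply pos_part_nonneg|apply exp_sum_Delta_nonneg
     |lra|apply exp_sum_Delta_nonneg]).
Qed.

(** The pair [n = 1], [h = 0] contributes a nonnegative minimum to the supremum. This rules out the
    value [m_infty]. *)
Lemma K_ge_0 (l r : nat -> R) : 0 <= l 1%nat -> Rbar_le 0 (K l r).
Proof.
  intros Hl.
  destruct (Gamma_min_exists l r 1 0) as [x Hx]; [lia|lra|].
  assert (0 <= x).
  { destruct Hx as [[m [_ ->]] _]. apply Gamma_nonneg. lra. }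
  apply Rbar_le_trans with (Finite x); [exact H|].
  apply (proj1 (Lub_Rbar_correct _)). exists 1%nat, 0.
  split; [lia|split; [lra|exact Hx]].
Qed.

(** The minimum is attained, so the supremum bound yields an actual index of the window. *)
Lemma Gamma_le_K (l r : nat -> R) (k : R) (n : nat) (h : R) :
  K l r = Finite k -> (1 <= n)%nat -> 0 <= h <= l n ->
  exists m, in_window l n h m /\ Gamma l r n m h <= k.
Proof.
  intros HK Hn Hh.
  destruct (Gamma_min_exists l r n h Hn Hh) as [x Hx].
  assert (Hxk : Rbar_le x (K l r)).
  { apply (proj1 (Lub_Rbar_correct _)). exists n, h. auto. }
  rewrite HK in Hxk.
  destruct Hx as [[m [Hm ->]] _]. exists m. split; [exact Hm|exact Hxk].
Qed.

Lemma Delta_le_sum (l r : nat -> R) (p q : nat) :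
  (p <= q)%nat -> Defs.Delta l r q <= sum_n_m (Defs.Delta l r) p q.
Proof.
  intros H. destruct (Nat.eq_dec p q) as [->|Hne].
  - rewrite sum_n_n. lra.
  - destruct q as [|q]; [lia|]. rewrite sum_Delta_step by lia.
    pose proof (sum_Delta_nonneg l r p q). lra.
Qed.

Lemma exp_le_Delta (l r : nat -> R) (k : nat) :
  exp (- / 2 * pos_part (l k + l (S k) - r k)) <= Defs.Delta l r k.
Proof.
  unfold Defs.Delta.
  pose proof (exp_pos (- l k)). pose proof (exp_pos (- l (S k))).
  pose proof (pos_part_nonneg (r k - l k - l (S k))). lra.
Qed.

Lemma Gamma_right_ge (l r : nat -> R) (n m : nat) (h : R) :
  (n < m)%nat -> h < l m -> l m - h <= Gamma l r n m h.
Proof.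
  intros Hm Hh. unfold Gamma.
  replace (Nat.compare m n) with Gt by (symmetry; apply Nat.compare_gt_iff; lia).
  destruct (Rle_dec (l m) h); [lra|].
  pose proof (exp_sum_Delta_nonneg l r n (m - 1) h). lra.
Qed.

Lemma Gamma_pred_ge (l r : nat -> R) (n : nat) (h : R) :
  l n <= h -> r n + h - l (S n) <= Gamma l r (S n) n h.
Proof.
  intros Hh. unfold Gamma.
  replace (Nat.compare n (S n)) with Lt by (symmetry; apply Nat.compare_lt_iff; lia).
  destruct (Rle_dec (l n) h); [|lra].
  pose proof (exp_sum_Delta_nonneg l r (n + 1) (S n - 1) h).
  pose proof (pos_part_ge (r n + h - l (n + 1)%nat)).
  rewrite Nat.add_1_r in *. lra.
Qed.

(** In both branches the sum ends at index [n], so it contains [Delta n] as soon as it is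
    nonempty. *)
Lemma Gamma_left_ge (l r : nat -> R) (n m : nat) (h : R) :
  (m <= n)%nat -> h < l n ->
  exp (h - / 2 * pos_part (l n + l (S n) - r n)) <= Gamma l r (S n) m h.
Proof.
  intros Hm Hh.
  assert (Hsum : forall p, (p <= n)%nat ->
    exp (h - / 2 * pos_part (l n + l (S n) - r n))
    <= exp h * sum_n_m (Defs.Delta l r) p n).
  { intros p Hp.
    replace (h - / 2 * pos_part (l n + l (S n) - r n))
      with (h + - / 2 * pos_part (l n + l (S n) - r n)) by ring.
    rewrite exp_plus.
    apply Rmult_le_compat_l; [left; apply exp_pos|].
    eapply Rle_trans; [apply exp_le_Delta|apply Delta_le_sum; exact Hp]. }
  unfold Gamma.
  replace (Nat.compare m (S n)) with Lt by (symmetry; apply Nat.compare_lt_iff; lia).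
  replace (S n - 1)%nat with n by lia.
  destruct (Rle_dec (l m) h) as [Hle|Hgt].
  (* Here the sum starts at [m + 1], so it would be empty for [m = n]; [h < l n] excludes this. *)
  - assert (m <> n) by (intros ->; lra).
    pose proof (pos_part_nonneg (r m + h - l (m + 1)%nat)).
    pose proof (Hsum (m + 1)%nat ltac:(lia)). lra.
  - pose proof (Hsum m Hm). lra.
Qed.

(** The index [n] lies in the set whose maximum is [A], so [A] is at least [n] and the default value
    [1] for an empty set does not arise. *)
Lemma in_window_ge_pred (l : nat -> R) (n m : nat) (h : R) :
  (1 <= n)%nat -> l n <= h -> in_window l (S n) h m -> (n <= m)%nat.
Proof.
  intros Hn Hh [A [B [HA [_ [HAm _]]]]].
  destruct HA as [[_ HA]|[HA _]].
  - specialize (HA n). assert (n <= A)%nat by (apply HA; split; [lia|exact Hh]). lia.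
  - destruct (HA n). split; [lia|exact Hh].
Qed.

Lemma r_le_of_K_finite (l r : nat -> R) (c1 k : R) (n : nat) :
  (forall m n : nat, (1 <= m <= n)%nat -> l m <= l n + c1) ->
  K l r = Finite k -> 0 <= k -> 0 < c1 -> (1 <= n)%nat ->
  4 * (k + c1) < l (S n) ->
  r n <= 2 * Rmax k 1 + 2 * ln (Rmax k 1) + 3 * c1.
Proof.
  intros Hl HK Hk Hc1 Hn Hbig.
  set (M := Rmax k 1).
  assert (HkM : k <= M) by apply Rmax_l.
  assert (H1M : 1 <= M) by apply Rmax_r.
  assert (HlnM : 0 <= ln M) by (rewrite <- ln_1; apply ln_le; lra).
  apply Rnot_lt_le. intros Hcontra.
  set (gap := r n - (2 * M + 2 * ln M + 3 * c1)).
  assert (Hgap : 0 < gap) by (unfold gap; lra).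
  (* The losses below are at most [2 * eps], which stays under [gap]; [eps <= c1] serves to get
     [k < h]. *)
  set (eps := Rmin (gap / 4) c1).
  assert (Heps : 0 < eps) by (apply Rmin_glb_lt; lra).
  assert (Heps1 : eps <= gap / 4) by apply Rmin_l.
  assert (Heps2 : eps <= c1) by apply Rmin_r.
  (* Since [l m >= l (S n) - c1] for [m > S n], each such [l m] exceeds [h] by at least
     [k + eps]. *)
  set (h := l (S n) - c1 - k - eps).
  assert (Hh : k < h) by (unfold h; lra).
  destruct (Gamma_le_K l r k (S n) h HK) as [m [Hw Hm]];
    [lia|unfold h in *; lra|].
  destruct (Nat.lt_trichotomy m (S n)) as [Hlt|[Heq|Hgt]].
  - destruct (Rle_lt_dec (l n) h) as [Hle|Hln].
    + assert (m = n) as ->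
        by (pose proof (in_window_ge_pred l n m h Hn Hle Hw); lia).
      pose proof (Gamma_pred_ge l r n h Hle). unfold h, gap in *. lra.
    + pose proof (Gamma_left_ge l r n m h ltac:(lia) Hln) as HG.
      set (y := l n + l (S n) - r n) in *.
      assert (Hy : h - / 2 * pos_part y <= ln M).
      { rewrite <- (ln_exp (h - / 2 * pos_part y)).
        apply ln_le; [apply exp_pos|lra]. }
      destruct (Rle_lt_dec y 0) as [Hy0|Hy0].
      (* The bound becomes [exp h <= k], against [exp h >= 1 + h > k]. *)
      * unfold pos_part in HG. rewrite Rmax_right in HG by exact Hy0.
        pose proof (exp_ineq1_le (h - / 2 * 0)). lra.
      * unfold pos_part in Hy. rewrite Rmax_left in Hy by lra.
        (* With [l n <= l (S n) + c1], [Hy] gives [r n <= 2 * k + 2 * ln M + 3 * c1 + 2 * eps]. *)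
        pose proof (Hl n (S n) ltac:(lia)). unfold y, h, gap in *. lra.
  - subst m. unfold Gamma in Hm. rewrite Nat.compare_refl in Hm.
    assert (k < Rmin h (l (S n) - h)) by (apply Rmin_glb_lt; unfold h in *; lra).
    lra.
  - pose proof (Hl (S n) m ltac:(lia)).
    pose proof (Gamma_right_ge l r (S n) m h Hgt ltac:(unfold h; lra)).
    unfold h in *. lra.
Qed.

Theorem theorem3p16
  (Omega : C -> Prop) (a b : nat -> Rbar) (lam : C -> R) (l r : nat -> R) (c1 : R)
  (Htrain : train Omega a b)
  (Hlam : poincare_density Omega lam)
  (Hlengths : train_lengths Omega a b lam l r)
  (Hhyp : gromov_hyperbolic Omega (poincare_dist Omega lam))
  (Hc1 : 0 < c1)
  (Hl : forall m n : nat, (1 <= m <= n)%nat -> l m <= l n + c1) :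
  forall n : nat, (1 <= n)%nat ->
    Rbar_lt (Rbar_mult 4 (Rbar_plus (K l r) c1)) (l (S n)) ->
    r n <= 2 * Rmax (real (K l r)) 1 + 2 * ln (Rmax (real (K l r)) 1) + 3 * c1.
Proof.
  intros n Hn Hlt.
  assert (Hl1 : 0 <= l 1%nat).
  { destruct (Hlengths 1%nat (le_n 1)) as [H _].
    exact (geodesic_half_length_nonneg _ _ _ _ _ _ _ H). }
  pose proof (K_ge_0 l r Hl1) as HK0.
  destruct (K l r) as [k| |] eqn:HK.
  - exact (r_le_of_K_finite l r c1 k n Hl HK HK0 Hc1 Hn Hlt).
  (* For an infinite supremum the assumption on [l (S n)] reads [p_infty < l (S n)], which is
     false. *)
  - exfalso. change (Rbar_plus p_infty c1) with p_infty in Hlt.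
    rewrite Rbar_mult_comm in Hlt.
    rewrite (is_Rbar_mult_unique _ _ _ (is_Rbar_mult_p_infty_pos 4 ltac:(simpl; lra)))
      in Hlt.
    exact Hlt.
  - destruct HK0.
Qed.
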